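(* Let $d_1\ge2$ be an integer and $b_0\in\mathbb C\setminus\{0\}$. Consider the system $$\dot x_1=-2x_1u_1,\qquad \dot x_2=x_2u_2,\qquad \dot u_1=-u_1u_2+\tfrac1{d_1}x_1,\qquad \dot u_2=-d_1u_1^2$$ and the ansatz $$x_1=\sum_{i\ge0}a_it^{-2+i},\quad x_2=\sum_{i\ge0}b_it^{d_1+i},\quad u_1=\sum_{i\ge0}c_it^{-1+i},\quad u_2=\sum_{i\ge0}e_it^{-1+i},$$ with $a_0=d_1(d_1-1)$, $c_0=1$, $e_0=d_1$. Then the compatibility conditions hold at the top resonance $i=2$, and therefore the ansatz yields a formal series solution of the system. Moreover, exactly one free parameter enters the expansion at the step $i=2$.
   Context: Substituting the ansatz in the system gives, for each $i\ge1$, the linear system $X(i)\,(a_i,b_i,c_i,e_i)^T=R_i$ with $$X(i)=\begin{pmatrix} i&0&2d_1(d_1-1)&0\\0&i&0&-b_0\\-1/d_1&0&i+(d_1-1)&1\\0&0&2d_1&i-1\end{pmatrix},\qquad R_i=\begin{pmatrix}-2\sum_{k=1}^{i-1}a_{i-k}c_k\\ \sum_{k=1}^{i-1}b_{i-k}e_k\\-\sum_{k=1}^{i-1}c_{i-k}e_k\\-d_1\sum_{k=1}^{i-1}c_{i-k}c_k\end{pmatrix}.$$ Resonances are the values of $i$ with $\det X(i)=0$; the largest (top) one is $i=2$. The compatibility conditions at $i=2$ hold if $R_2$ (computed from the coefficients of the previous step) lies in the image of $X(2)$. ''Exactly one free parameter enters at step $i$'' means that the solution set of the linear system at step $i$ is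 a one-dimensional affine space. *)

(* Defs.v *)
From HB Require Import structures.
From mathcomp Require Import all_boot all_order all_algebra.
From mathcomp Require Import complex reals.

Set Implicit Arguments.
Unset Strict Implicit.
Unset Printing Implicit Defensive.

Import Order.TTheory GRing.Theory Num.Theory.
Local Open Scope ring_scope.

Section FormalLaurentSeries.
Variable K : fieldType.

(* Laurent n f represents t^n * \sum_(i >= 0) f i t^i.  As f 0 may vanish, a
   series has several representations, so series are compared through their
   coefficients (laurent_eq), never by Leibniz equality. *)
Record laurent := Laurent { lord : int; lfun : nat -> K }.

Definition lcoef (f : laurent) (m : int) : K :=
  if m - lord f is Posz k then lfun f k else 0.

Definition laurent_eq (f g : laurent) : Prop := forall m, lcoef f m = lcoef g m.

Definition ladd (f g : laurent) : laurent :=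
  let n := Num.min (lord f) (lord g) in
  Laurent n (fun k => lcoef f (n + k%:Z) + lcoef g (n + k%:Z)).

Definition lscale (z : K) (f : laurent) : laurent :=
  Laurent (lord f) (fun k => z * lfun f k).

Definition lmul (f g : laurent) : laurent :=
  Laurent (lord f + lord g)
    (fun n => \sum_(k < n.+1) lfun f k * lfun g (n - k)%N).

Definition lderiv (f : laurent) : laurent :=
  Laurent (lord f - 1) (fun k => (lord f + k%:Z)%:~R * lfun f k).

Lemma lcoefD f g m : lcoef (ladd f g) m = lcoef f m + lcoef g m.
Proof.
rewrite {1}/lcoef /=; set n := Num.min _ _.
case E: (m - n) => [k|k].
  by rewrite -E addrCA subrr addr0.
have lt_mn : m < n by rewrite -subr_lt0 E.
have lcoef0 h : n <= lord h -> lcoef h m = 0.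
  rewrite /lcoef => le_nh; case F: (m - lord h) => [j|//].
  by have := lt_le_trans lt_mn le_nh; rewrite -subr_lt0 F.
by rewrite !lcoef0 ?addr0 // ge_min lexx ?orbT.
Qed.

Lemma lcoefZ z f m : lcoef (lscale z f) m = z * lcoef f m.
Proof. by rewrite /lcoef /=; case: (m - lord f) => // k; rewrite mulr0. Qed.

Lemma lcoef_deriv f m : lcoef (lderiv f) m = (m + 1)%:~R * lcoef f (m + 1).
Proof.
rewrite /lcoef /= opprB addrA.
by case E: (m + 1 - lord f) => [k|k]; rewrite ?mulr0 // -E addrCA subrr addr0.
Qed.

End FormalLaurentSeries.

Section Ansatz.
Variable K : fieldType.

(* The coefficient sequences (a_i), (b_i), (c_i), (e_i) of x1, x2, u1, u2. *)
Record coefs := Coefs { ca : nat -> K; cb : nat -> K; cc : nat -> K; ce : nat -> K }.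

Definition x1_series (s : coefs) : laurent K := Laurent (- 2%:Z) (ca s).
Definition x2_series (d1 : nat) (s : coefs) : laurent K := Laurent d1%:Z (cb s).
Definition u1_series (s : coefs) : laurent K := Laurent (- 1%:Z) (cc s).
Definition u2_series (s : coefs) : laurent K := Laurent (- 1%:Z) (ce s).

Definition leading_terms (d1 : nat) (b0 : K) (s : coefs) : Prop :=
  [/\ ca s 0%N = d1%:R * (d1%:R - 1), cb s 0%N = b0, cc s 0%N = 1
    & ce s 0%N = d1%:R].

Definition solves_system (d1 : nat) (x1 x2 u1 u2 : laurent K) : Prop :=
  [/\ laurent_eq (lderiv x1) (lscale (- 2%:R) (lmul x1 u1)),
      laurent_eq (lderiv x2) (lmul x2 u2),
      laurent_eq (lderiv u1)
        (ladd (lscale (- 1) (lmul u1 u2)) (lscale (1 / d1%:R) x1))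
    & laurent_eq (lderiv u2) (lscale (- d1%:R) (lmul u1 u1))].

Definition formal_solution (d1 : nat) (s : coefs) : Prop :=
  solves_system d1 (x1_series s) (x2_series d1 s) (u1_series s) (u2_series s).

Definition Xmx (d1 : nat) (b0 z : K) : 'M[K]_4 :=
  let d : K := d1%:R in
  \matrix_(j, k) nth 0 (nth [::]
    [:: [:: z;       0; 2%:R * d * (d - 1); 0];
        [:: 0;       z; 0;                  - b0];
        [:: - 1 / d; 0; z + (d - 1);        1];
        [:: 0;       0; 2%:R * d;           z - 1]] j) k.

Definition Rvec (d1 : nat) (s : coefs) (i : nat) : 'cV[K]_4 :=
  \col_j nth 0
    [:: - 2%:R * \sum_(1 <= k < i) ca s (i - k)%N * cc s k;
        \sum_(1 <= k < i) cb s (i - k)%N * ce s k;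
        - \sum_(1 <= k < i) cc s (i - k)%N * ce s k;
        - d1%:R * \sum_(1 <= k < i) cc s (i - k)%N * cc s k] j.

Definition coefvec (s : coefs) (i : nat) : 'cV[K]_4 :=
  \col_j nth 0 [:: ca s i; cb s i; cc s i; ce s i] j.

Definition step_solution (d1 : nat) (b0 : K) (s : coefs) (i : nat)
    (v : 'cV[K]_4) : Prop :=
  Xmx d1 b0 i%:R *m v = Rvec d1 s i.

Definition satisfies_step (d1 : nat) (b0 : K) (s : coefs) (i : nat) : Prop :=
  step_solution d1 b0 s i (coefvec s i).

Definition compatible (d1 : nat) (b0 : K) (s : coefs) (i : nat) : Prop :=
  exists v, step_solution d1 b0 s i v.

Definition resonance (d1 : nat) (b0 z : K) : Prop := \det (Xmx d1 b0 z) = 0.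

Definition affine_of_dim (V : vectType K) (S : V -> Prop) (n : nat) : Prop :=
  exists (v0 : V) (U : {vspace V}),
    \dim U = n /\ forall v, S v <-> v - v0 \in U.

End Ansatz.

(* z <= z0 in R[i] says that z0 - z is real and nonnegative, so a top resonance
   z0 also forces all resonances to lie on the same horizontal line. *)
Definition top_resonance (R : realType) (d1 : nat) (b0 z0 : R[i]) : Prop :=
  resonance d1 b0 z0 /\ forall z, resonance d1 b0 z -> z <= z0.

(* Main.v *)
Require Import Defs.
From HB Require Import structures.
From mathcomp Require Import all_boot all_order all_algebra.
From mathcomp Require Import complex reals.
From mathcomp Require Import ring.

(** Comparing coefficients turns the system into the triangular family of linear
    systems [X(i) v_i = R_i], the equations at [i = 0] being the choice of
    leading terms.  Since [det X(i) = i (i - 2) (i + 1) (i + d1 - 1)], the matrix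
    [X(1)] is invertible, and [R_1 = 0] is an empty sum, so the first-order
    coefficients vanish and [R_2 = 0]: step 2 is homogeneous, hence compatible,
    and its solutions form the kernel of [X(2)], which is the line spanned by
    [(- d1 (d1 - 1), - b0 d1, 1, - 2 d1)].  All later steps are uniquely
    solvable. *)

Set Implicit Arguments.
Unset Strict Implicit.
Unset Printing Implicit Defensive.

Import Order.TTheory GRing.Theory Num.Theory.
Local Open Scope ring_scope.

(** This constructs sequences whose n-th term is computed from all earlier ones. Iterating [F] from
    a constant sequence freezes the term of index n after n+1 rounds, so the diagonal of the
    iterates is a fixed point. *)
Lemma course_of_values_fixpoint (T : Type) (F : (nat -> T) -> nat -> T) :
  (forall f g n, (forall k, (k < n)%N -> f k = g k) -> F f n = F g n) ->
  inhabited T -> exists f, forall n, f n = F f n.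
Proof.
move=> Fext [x0]; pose G m := iter m F (fun=> x0).
have GE n m : (n < m)%N -> G m n = G n.+1 n.
  elim/ltn_ind: n m => n IH [//|m]; rewrite ltnS => le_nm.
  apply: Fext => k lt_kn; transitivity (G k.+1 k); last exact/esym/IH.
  by apply: IH => //; apply: leq_trans le_nm.
exists (fun n => G n.+1 n) => n; apply: Fext => k lt_kn; exact: GE.
Qed.

Lemma big_nat_ends (V : nmodType) (i : nat) (F : nat -> V) :
  \sum_(0 <= k < i.+2) F k = F 0%N + F i.+1 + \sum_(1 <= k < i.+1) F k.
Proof. by rewrite big_nat_recr //= big_ltn // -addrA [X in _ + X]addrC addrA. Qed.

Section Vec4.
Variable K : fieldType.

Definition vec4 (a b c e : K) : 'cV[K]_4 := \col_j nth 0 [:: a; b; c; e] j.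

Definition entry4 (v : 'cV[K]_4) (k : nat) : K := v (inord k) 0.

Lemma entry4_vec4 a b c e k :
  (k < 4)%N -> entry4 (vec4 a b c e) k = nth 0 [:: a; b; c; e] k.
Proof. by move=> lt_k4; rewrite /entry4 mxE inordK. Qed.

Lemma vec4E v : v = vec4 (entry4 v 0) (entry4 v 1) (entry4 v 2) (entry4 v 3).
Proof.
apply/matrixP => j k; rewrite ord1 mxE /entry4.
case: j => -[|[|[|[|//]]]] lt_j4 /=; congr (v _ _); apply/val_inj;
  by rewrite /= inordK.
Qed.

Lemma vec4_inj a b c e a' b' c' e' :
  vec4 a b c e = vec4 a' b' c' e' -> [/\ a = a', b = b', c = c' & e = e'].
Proof.
move=> E; have H k : entry4 (vec4 a b c e) k = entry4 (vec4 a' b' c' e') k.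
  by rewrite E.
by split; [have := H 0%N | have := H 1%N | have := H 2%N | have := H 3%N];
  rewrite !entry4_vec4.
Qed.

Lemma vec4_0 : vec4 0 0 0 0 = 0.
Proof. by apply/matrixP => -[[|[|[|[|//]]]] ?] k; rewrite !mxE. Qed.

Lemma scale_vec4 z a b c e :
  z *: vec4 a b c e = vec4 (z * a) (z * b) (z * c) (z * e).
Proof. by apply/matrixP => -[[|[|[|[|//]]]] ?] k; rewrite !mxE. Qed.

End Vec4.

Lemma lcoef_Laurent (K : fieldType) (n : int) (f : nat -> K) (k : nat) :
  lcoef (Laurent n f) (n + k%:Z) = f k.
Proof. by rewrite /lcoef /= addrAC subrr add0r. Qed.

(** In each of the four equations both sides have the same order, so this reduces them to identities
    between coefficient sequences. *)
Lemma laurent_eq_lfun (K : fieldType) (f g : laurent K) :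
  lord f = lord g -> lfun f =1 lfun g -> laurent_eq f g.
Proof. by move=> ord_eq fun_eq m; rewrite /lcoef ord_eq; case: (_ - _). Qed.

(** In each sum both indices k and i - k range over 1, ..., i - 1. This is what makes the family of
    systems triangular. *)
Lemma eq_Rvec (K : fieldType) (d1 : nat) (s s' : coefs K) (i : nat) :
  (forall k, (0 < k < i)%N -> coefvec s k = coefvec s' k) ->
  Rvec d1 s i = Rvec d1 s' i.
Proof.
move=> eq_s.
have eqs k : (1 <= k < i)%N -> [/\ ca s k = ca s' k, cb s k = cb s' k,
    cc s k = cc s' k & ce s k = ce s' k].
  by move=> /eq_s/vec4_inj.
have sum_eq (f g f' g' : nat -> K) :
    (forall k, (1 <= k < i)%N -> f k = f' k /\ g k = g' k) ->
  \sum_(1 <= k < i) f (i - k)%N * g k = \sum_(1 <= k < i) f' (i - k)%N * g' k.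
  move=> fg; rewrite big_nat [RHS]big_nat; apply: eq_bigr => k /andP[k_gt0 lt_ki].
  have k_in : (1 <= k < i)%N by rewrite k_gt0.
  have ik_in : (1 <= i - k < i)%N.
    by rewrite subn_gt0 lt_ki ltn_subrL k_gt0 (leq_trans _ lt_ki).
  by have [_ ->] := fg _ k_in; have [-> _] := fg _ ik_in.
rewrite /Rvec (sum_eq (ca s) (cc s) (ca s') (cc s'))
  ?(sum_eq (cb s) (ce s) (cb s') (ce s')) ?(sum_eq (cc s) (ce s) (cc s') (ce s'))
  ?(sum_eq (cc s) (cc s) (cc s') (cc s')) //.
all: by move=> k /eqs[].
Qed.

Section Recursion.
Variables (K : fieldType) (d1 : nat) (b0 : K).
Local Notation d := (d1%:R : K).
Hypothesis d_neq0 : d != 0.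

Lemma Xmx_mul_vec4 z a b c e :
  Xmx d1 b0 z *m vec4 a b c e =
  vec4 (z * a + 2%:R * d * (d - 1) * c) (z * b - b0 * e)
       (- a / d + (z + (d - 1)) * c + e) (2%:R * d * c + (z - 1) * e).
Proof.
apply/matrixP => -[[|[|[|[|//]]]] ?] k;
  rewrite !mxE !big_ord_recl big_ord0 !mxE /=; by field.
Qed.

Lemma det_Xmx z :
  \det (Xmx d1 b0 z) = z * (z - 2%:R) * (z + 1) * (z + (d - 1)).
Proof.
(* Expand along the second column, whose only nonzero entry is the diagonal one, z. *)
rewrite (expand_det_col _ (lift ord0 ord0)) !big_ord_recl big_ord0.
rewrite ![Xmx _ _ _ _ _]mxE /= !mul0r !add0r !addr0 /cofactor.
rewrite !(expand_det_row _ ord0) !big_ord_recl !big_ord0 /cofactor.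
rewrite !(expand_det_row _ ord0) !big_ord_recl !big_ord0 /cofactor !det_mx11.
rewrite !mxE /= /bump /=.
by field.
Qed.

Lemma formal_solution_of_steps (s : coefs K) :
  leading_terms d1 b0 s -> (forall i, satisfies_step d1 b0 s i.+1) ->
  formal_solution d1 s.
Proof.
case=> a0 b0E c0 e0 steps.
(* The two extreme terms of the Cauchy product carry the unknowns of index i+1 and go into X(i+1).
   The inner sum, reversed to match [Rvec], goes into R_{i+1}. *)
have sumE (f g : nat -> K) i : \sum_(k < i.+2) f k * g (i.+1 - k)%N =
    f i.+1 * g 0%N + f 0%N * g i.+1 + \sum_(1 <= k < i.+1) f (i.+1 - k)%N * g k.
  rewrite -(big_mkord xpredT (fun k => f k * g (i.+1 - k)%N)) big_nat_rev /=.
  rewrite big_nat_ends add0n !subn1 /= !subnn subn0; congr (_ + _ + _).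
  rewrite [LHS]big_nat [RHS]big_nat; apply: eq_bigr => k /andP[_ lt_ki].
  by rewrite subSS subKn // ltnW.
(* [coefvec] and [Rvec] are instances of [vec4] up to conversion, so each step splits into four
   scalar equations. *)
have stepE i := vec4_inj (etrans (esym (Xmx_mul_vec4 _ _ _ _ _)) (steps i)).
split.
- apply: laurent_eq_lfun => // -[|i] /=.
    by rewrite big_ord1 c0 addr0; ring.
  have [E _ _ _] := stepE i; rewrite sumE a0 c0 mulrDr -E intrD; ring.
- apply: laurent_eq_lfun => // -[|i] /=.
    by rewrite big_ord1 e0 addr0; ring.
  have [_ E _ _] := stepE i; rewrite sumE b0E e0 -E intrD; ring.
- apply: laurent_eq_lfun => // k.
  (* Both summands on the right have order -2, so [ladd] reads them at the same index k. *)
  rewrite [RHS]/= !lcoef_Laurent; case: k => [|i] /=.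
    by rewrite big_ord1 a0 c0 e0; field.
  have [_ _ E _] := stepE i; rewrite sumE c0 e0 mulrDr mulN1r mulN1r -E intrD.
  by field.
- apply: laurent_eq_lfun => // -[|i] /=.
    by rewrite big_ord1 c0 e0; ring.
  have [_ _ _ E] := stepE i; rewrite sumE c0 mulrDr -E intrD; ring.
Qed.

Lemma first_step_eq0 (s : coefs K) :
  \det (Xmx d1 b0 1) != 0 -> satisfies_step d1 b0 s 1 -> coefvec s 1 = 0.
Proof.
rewrite -unitfE -unitmxE => X1_unit.
have R1 : Rvec d1 s 1 = 0.
  rewrite -[RHS]vec4_0; apply/matrixP => j k.
  by rewrite !mxE !big_geq // !(mulr0, oppr0).
rewrite /satisfies_step /step_solution R1 => step1.
by rewrite -[LHS](mulKmx X1_unit) step1 mulmx0.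
Qed.

Lemma Rvec2_eq0 (s : coefs K) : coefvec s 1 = 0 -> Rvec d1 s 2 = 0.
Proof.
rewrite -vec4_0 => /vec4_inj[a1 b1 c1 e1].
apply/matrixP => j k.
by rewrite !mxE !big_nat1 a1 b1 c1 e1 !(mulr0, oppr0).
Qed.

(** With c as parameter, the last row gives e = -2dc, and the first two rows, after cancelling 2,
    give a = -d(d-1)c and b = -b0 d c. The third row then reads (d-1)c + (d+1)c - 2dc = 0. *)
Lemma kernel_Xmx2 (v : 'cV[K]_4) : (2%:R : K) != 0 ->
  Xmx d1 b0 2%:R *m v = 0 <->
  v \in <[vec4 (- (d * (d - 1))) (- (b0 * d)) 1 (- (2%:R * d))]>%VS.
Proof.
move=> two_neq0; split=> [|/vlineP[z ->]]; last first.
  rewrite scale_vec4 Xmx_mul_vec4 -vec4_0; congr vec4; by field.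
rewrite [v]vec4E Xmx_mul_vec4 -vec4_0 => /vec4_inj[Ea Eb Ec Ee].
apply/vlineP; exists (entry4 v 2); rewrite scale_vec4.
have e_c : entry4 v 3 = - (2%:R * d) * entry4 v 2.
  by apply/eqP; rewrite -subr_eq0 -Ee; apply/eqP; ring.
congr vec4; rewrite ?mulr1 //.
- by apply: (mulfI two_neq0); apply/eqP; rewrite -subr_eq0 -Ea; apply/eqP; ring.
- apply: (mulfI two_neq0); apply/eqP; rewrite -subr_eq0 -Eb e_c; apply/eqP; ring.
- by rewrite e_c mulrC.
Qed.

(** Any choice made at step 2 extends to all orders: from index 3 on, inverting X(i) determines each
    coefficient vector from the earlier ones. *)
Lemma solution_of_coefs2 (v2 : 'cV[K]_4) (s : coefs K) :
  leading_terms d1 b0 s -> satisfies_step d1 b0 s 1 ->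
  step_solution d1 b0 s 2 v2 ->
  (forall i, \det (Xmx d1 b0 i.+3%:R) != 0) ->
  exists s' : coefs K, [/\ leading_terms d1 b0 s', coefvec s' 1 = coefvec s 1,
    coefvec s' 2 = v2 & formal_solution d1 s'].
Proof.
move=> lead step1 step2 X_unit.
pose coefs_of (f : nat -> 'cV[K]_4) :=
  Coefs (fun i => entry4 (f i) 0) (fun i => entry4 (f i) 1)
        (fun i => entry4 (f i) 2) (fun i => entry4 (f i) 3).
have coefvec_of f i : coefvec (coefs_of f) i = f i by rewrite [RHS]vec4E.
pose F f i := match i with
  | 0 | 1 => coefvec s i
  | 2 => v2
  | _ => invmx (Xmx d1 b0 i%:R) *m Rvec d1 (coefs_of f) i
  end.
have [f g n fg|//|f fE] := @course_of_values_fixpoint _ F.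
  case: n fg => [|[|[|n]]] // fg; rewrite /F; congr (_ *m _).
  by apply: eq_Rvec => k /andP[_ lt_k]; rewrite !coefvec_of fg.
have sE i : coefvec (coefs_of f) i = F f i by rewrite coefvec_of fE.
have lead' : leading_terms d1 b0 (coefs_of f).
  have [? ? ? ?] := vec4_inj (sE 0%N).
  by case: lead => *; split; etransitivity; eassumption.
exists (coefs_of f); split; [exact: lead' | exact: (sE 1) | exact: (sE 2) |].
apply: formal_solution_of_steps => // i.
rewrite /satisfies_step /step_solution sE.
case: i => [|[|i]].
(* R_1 and R_2 involve no index above 1, where the new sequence agrees with [s]. *)
- rewrite /F step1; apply: eq_Rvec => -[|//] _; exact/esym/sE.
- rewrite /F step2; apply: eq_Rvec => -[|[|//]] _; exact/esym/sE.
- by rewrite /F mulKVmx // unitmxE unitfE.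
Qed.

End Recursion.

Theorem proposition3p4 (R : realType) (d1 : nat) (b0 : R[i])
    (hd1 : (2 <= d1)%N) (hb0 : b0 != 0) :
  top_resonance d1 b0 2%:R /\
  (forall s : coefs R[i], leading_terms d1 b0 s -> satisfies_step d1 b0 s 1 ->
     compatible d1 b0 s 2) /\
  (exists s : coefs R[i], leading_terms d1 b0 s /\ formal_solution d1 s) /\
  (forall s : coefs R[i], leading_terms d1 b0 s -> satisfies_step d1 b0 s 1 ->
     affine_of_dim (step_solution d1 b0 s 2) 1 /\
     forall v, step_solution d1 b0 s 2 v ->
       exists s' : coefs R[i],
         [/\ leading_terms d1 b0 s', coefvec s' 1 = coefvec s 1,
             coefvec s' 2 = v & formal_solution d1 s']).
Proof.
have d_neq0 : (d1%:R : R[i]) != 0 by rewrite pnatr_eq0 -lt0n ltnW.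
have two_neq0 : (2%:R : R[i]) != 0 by rewrite pnatr_eq0.
have d_ge1 : 0 <= (d1%:R - 1 : R[i]) by rewrite subr_ge0 ler1n ltnW.
have det_neq0 i : i.+1 != 2%N -> \det (Xmx d1 b0 i.+1%:R) != 0.
  move=> i_neq1; rewrite det_Xmx // !mulf_neq0 ?pnatr_eq0 //.
  - by rewrite subr_eq0 eqr_nat.
  - by rewrite natr1 pnatr_eq0.
  (* Here i+1 > 0 and d1 - 1 >= 0 are real elements of [R[i]], hence comparable with 0. *)
  - by rewrite gt_eqF // ltr_wpDr // ltr0n.
have R2_eq0 s : satisfies_step d1 b0 s 1 -> Rvec d1 s 2 = 0.
  by move=> step1; apply/Rvec2_eq0/(first_step_eq0 _ step1)/(det_neq0 0).
have compat s : satisfies_step d1 b0 s 1 -> step_solution d1 b0 s 2 0.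
  by move=> step1; rewrite /step_solution mulmx0 R2_eq0.
have solve s v := @solution_of_coefs2 _ d1 b0 d_neq0 v s.
split; last split; last split.
- split=> [|z]; rewrite /resonance det_Xmx //; first by rewrite subrr mulr0 !mul0r.
  move/eqP; rewrite !mulf_eq0 subr_eq0 -orbA -orbA !addr_eq0.
  (* The roots are 0, 2, -1 and 1 - d1, all real and at most 2. *)
  case/or4P=> /eqP->; rewrite ?ler0n ?lexx //.
  + exact: le_trans (lerN10 _) (ler0n _ _).
  + by apply: le_trans (ler0n _ _); rewrite oppr_le0.
- by move=> s _ step1; exists 0; apply: compat.
(* The leading terms padded with zeros satisfy step 1, both of whose sides vanish. Choosing 0 at
   step 2 then gives a solution. *)
- pose s := @Coefs R[i] (fun i => if i is 0 then d1%:R * (d1%:R - 1) else 0)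
    (fun i => if i is 0 then b0 else 0) (fun i => if i is 0 then 1 else 0)
    (fun i => if i is 0 then d1%:R else 0).
  have step1 : satisfies_step d1 b0 s 1.
    rewrite /satisfies_step /step_solution.
    rewrite [coefvec _ _]vec4_0 mulmx0 -[LHS]vec4_0.
    by apply/matrixP => j k; rewrite !mxE !big_geq // !(mulr0, oppr0).
  have [//||s' [lead _ _ sol]] := solve s 0 _ step1 (compat s step1).
    by move=> i; apply: det_neq0.
  by exists s'.
- move=> s lead step1; split=> [|v step2].
    exists 0, <[vec4 (- (d1%:R * (d1%:R - 1))) (- (b0 * d1%:R)) 1
                     (- (2%:R * d1%:R))]>%VS.
    split=> [|v]; last by rewrite subr0 /step_solution R2_eq0 // kernel_Xmx2.
    (* The spanning vector is nonzero because its third coordinate, the free value of c_2, is 1. *)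
    rewrite dim_vline; case: eqP => // /(congr1 (fun v => entry4 v 2)).
    by rewrite -vec4_0 !entry4_vec4 //= => /eqP; rewrite oner_eq0.
  by apply: solve => // i; apply: det_neq0.
Qed.
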